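(* Let $\sigma=(Z,\mathcal{A})\in\mathcal{U}(\mathcal{A})^{\Phi}$ and let $\mathcal{K}$ be any of the four subcategories $\mathcal{K}^{I}_1,\mathcal{K}^{I}_2,\mathcal{K}^{II}_1,\mathcal{K}^{II}_2$ of $\mathcal{A}$ (each equivalent to the category $\mathrm{rep}(K_2)$ of finite-dimensional representations of the Kronecker quiver $K_2$). Let $\overline{Z}$ be the stability function on $\mathcal{K}\simeq\mathrm{rep}(K_2)$ obtained by composing $Z$ with the map $K_0(\mathcal{K})\to K_0(\mathcal{A})$ induced by the inclusion. Then every object of $\mathcal{K}$ that is stable with respect to $\overline{Z}$ is stable as an object of $\mathcal{A}$ with respect to $\sigma$.
   Context: Everything is over $\mathbb{C}$. Let $p_1,p_2:\mathbb{P}^1\times\mathbb{P}^1\to\mathbb{P}^1$ be the projections, $\mathcal{O}(a,b)=p_1^*\mathcal{O}(a)\otimes p_2^*\mathcal{O}(b)$, $X$ the total space of the canonical bundle of $\mathbb{P}^1\times\mathbb{P}^1$, $\pi:X\to\mathbb{P}^1\times\mathbb{P}^1$ the projection and $s:\mathbb{P}^1\times\mathbb{P}^1\to X$ the zero section. $D^b_0(X)\subset D^b(X)$ is the full subcategory of objects set-theoretically supported on the zero section. Let $\mathcal{Q}=\bigoplus_{i=0}^3\pi^*E_i$ with $(E_0,E_1,E_2,E_3)=(\mathcal{O},\mathcal{O}(1,0),\mathcal{O}(1,1),\mathcal{O}(2,1))$, a tilting object, and $B=\mathrm{End}_X(\mathcal{Q})$, presented as the path algebra of a quiver with vertices $0,1,2,3$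 (vertex $i$ corresponding to $\pi^*E_i$), with two arrows $i\to i+1$ for each $i\in\mathbb{Z}/4$, modulo relations homogeneous for path length. A right $B$-module $M$ is nilpotent if $MB_n=0$ for some $n>0$. $\mathbb{R}\mathrm{Hom}_X(\mathcal{Q},-)$ identifies $D^b_0(X)$ with the full subcategory of $D^b(B)$ of complexes with nilpotent cohomology; $\mathcal{A}\subset D^b_0(X)$ is the heart corresponding to the category of (finitely generated) nilpotent right $B$-modules. $\mathcal{A}$ has finite length with simple objects $S_0=s_*\mathcal{O}$, $S_1=s_*\mathcal{O}(-1,0)[1]$, $S_2=s_*\mathcal{O}(1,-1)[1]$, $S_3=s_*\mathcal{O}(0,-1)[2]$ ($S_i$ is the simple at vertex $i$), and $\gamma_i=[S_i]$ is a basis of $K_0(\mathcal{A})=K_0(D^b_0(X))\cong\mathbb{Z}^4$. $\mathcal{K}^I_1,\mathcal{K}^I_2,\mathcal{K}^{II}_1,\mathcal{K}^{II}_2$ are the full subcategories of $\mathcal{A}$ of nilpotent representations supported on the vertices $\{0,1\}$, $\{2,3\}$, $\{1,2\}$, $\{3,0\}$ respectively (all composition factors are the corresponding $S_j$). $K_2$ is the quiver with two vertices and two parallel arrows. A stability function on an abelian category is a homomorphism $Z$ from its $K_0$ to $\mathbb{C}$ sending each nonzero object into $H=\{re^{i\pi\phi}:r>0,\ 0<\phi\le1\}$; the phase of a nonzero object $E$ is $\phi(E)=\frac1\pi\arg Z(E)\in(0,1]$, and $E$ is stable if $\phi(A)<\phi(E)$ for all proper nonzero subobjects $A\subset E$.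 $\mathrm{Stab}(X)$ is the space of (Bridgeland) stability conditions $(Z,\mathcal{P})$ on $D^b_0(X)$ with the support property, equivalently written $(Z,\mathcal{P}((0,1]))$. Let $\Psi=\tau^*\circ\mathrm{Tw}_{S_0}\circ(-\otimes\pi^*\mathcal{O}(0,1))$, where $\tau$ is the automorphism of $X$ induced by swapping the two factors of $\mathbb{P}^1\times\mathbb{P}^1$ and $\mathrm{Tw}_{S_0}(E)=\mathrm{Cone}(\mathrm{Hom}^\bullet(S_0,E)\otimes S_0\to E)$; $\Psi(S_i)=S_{i+1}$ ($i\in\mathbb{Z}/4$). Put $\Phi=\Psi^2$. $\mathcal{U}(\mathcal{A})^\Phi$ is the set of $\Phi$-invariant stability conditions with heart $\mathcal{P}((0,1])=\mathcal{A}$; these are the ones determined by values $Z(\gamma_0)=Z(\gamma_2)\in H$ and $Z(\gamma_1)=Z(\gamma_3)\in H$. *)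

(* Defs.v *)
From HB Require Import structures.
From mathcomp Require Import all_boot all_order all_algebra.
From mathcomp Require Import boolp classical_sets reals trigo.
From mathcomp Require Import complex freeg.

Set Implicit Arguments.
Unset Strict Implicit.
Unset Printing Implicit Defensive.

Import Order.TTheory GRing.Theory Num.Theory.

Local Open Scope ring_scope.
Local Open Scope quotient_scope.

(* Right B-modules, for B = End_X(Q), where X is the total space of the canonical
   bundle pi : X -> P^1 x P^1 and Q is the sum of the pi^*E_i, for
   (E_0,...,E_3) = (O, O(1,0), O(1,1), O(2,1)).

   The sections of O(a,b) on X are the elements of bidegree (a,b) of the Cox
   ring C[x_0,x_1,y_0,y_1,t], with x_a of bidegree (1,0), y_a of bidegree (0,1)
   and t of bidegree (-2,-2).  The two arrows i -> i+1 (a : 'I_2) are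
   multiplication by x_a for i = 0, 2 and by y_a for i = 1, 3; the arrows
   3 -> 0 land in Hom(pi^*O(2,1), pi^*O(2,2).t) = Hom(pi^*E_3, pi^*E_0).
   Paths map onto monomials, and two parallel paths have the same image iff they
   differ by permuting the labels of the x-arrows and those of the y-arrows;
   hence the relations of B are generated by the cubic ones
     x_a y_b x_c = x_c y_b x_a   and   y_a x_b y_c = y_c x_b y_a.

   Composition makes Hom(Q, -) a right module, so an arrow i -> i+1 acts as a
   map M_(i+1) -> M_i.  A finitely generated nilpotent module is finite
   dimensional; it is given in coordinates, M_i being the space of row vectors
   of length rdim M i, with arrows acting by right multiplication. *)
Record rep (R : realType) := Rep {
  rdim : 'Z_4 -> nat;
  arr : forall (i : 'Z_4), 'I_2 -> 'M[R[i]]_(rdim (i + 1), rdim i);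
  arr_rel : forall (i : 'Z_4) (a b c : 'I_2),
    arr (i + 1 + 1) a *m arr (i + 1) b *m arr i c
    = arr (i + 1 + 1) c *m arr (i + 1) b *m arr i a }.

(* A word w is read as a path of length [size w] from i to [pend i w]. *)
Fixpoint pend (i : 'Z_4) (w : seq 'I_2) : 'Z_4 :=
  if w is _ :: w' then pend (i + 1) w' else i.

Fixpoint pact (R : realType) (M : rep R) (i : 'Z_4) (w : seq 'I_2) :
    'M[R[i]]_(rdim M (pend i w), rdim M i) :=
  match w with
  | [::] => 1%:M
  | a :: w' => pact M (i + 1) w' *m arr M i a
  end.

Definition nilpotent_rep (R : realType) (M : rep R) : Prop :=
  exists2 n : nat, (0 < n)%N & forall i w, size w = n -> pact M i w = 0.

(* K^I_1, K^II_1, K^I_2, K^II_2 are [kron 0], [kron 1], [kron 2], [kron 3]. *)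
Definition kron (R : realType) (i : 'Z_4) (M : rep R) : Prop :=
  nilpotent_rep M /\ forall j, j \notin [set i; i + 1] -> rdim M j = 0%N.

Lemma kron_nilpotent (R : realType) (i : 'Z_4) (M : rep R) :
  kron i M -> nilpotent_rep M.
Proof. by case. Qed.

Record hom (R : realType) (M N : rep R) := Hom {
  hmap : forall i : 'Z_4, 'M[R[i]]_(rdim M i, rdim N i);
  hmap_arr : forall i a, arr M i a *m hmap i = hmap (i + 1) *m arr N i a }.

Definition is_zero (R : realType) (M : rep R) : Prop :=
  forall i, rdim M i = 0%N.

Definition is_mono (R : realType) (M N : rep R) (f : hom M N) : Prop :=
  forall i, row_free (hmap f i).

Definition is_epi (R : realType) (M N : rep R) (f : hom M N) : Prop :=
  forall i, row_full (hmap f i).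

Definition short_exact (R : realType) (L M N : rep R)
    (f : hom L M) (g : hom M N) : Prop :=
  [/\ is_mono f, is_epi g & forall i, (hmap f i :=: kermx (hmap g i))%MS].

(* The Grothendieck group of the full subcategory of objects satisfying P, for
   P closed under subobjects and quotients: the free abelian group on its
   objects modulo the subgroup generated by the short exact sequences. *)
Definition obj (R : realType) (P : rep R -> Prop) : Type :=
  {classic {M : rep R | P M}}.

Definition obj_rep (R : realType) (P : rep R -> Prop) (E : obj P) : rep R :=
  sval E.
Coercion obj_rep : obj >-> rep.

Section GrothendieckGroup.
Variables (R : realType) (P : rep R -> Prop).

Definition K0_relations : {pred {freeg (obj P)}} := fun x =>
  `[< forall H : {pred {freeg (obj P)}}, GRing.zmod_closed H ->
      (forall (L M N : obj P) (f : hom L M) (g : hom M N),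
        short_exact f g -> << M >> - << L >> - << N >> \in H) ->
      x \in H >].

Lemma K0_relations_zmod : GRing.zmod_closed K0_relations.
Proof.
split=> [|x y /asboolP Hx /asboolP Hy]; apply/asboolP => H Hz Hr.
  by case: Hz.
by case: (Hz) => _; apply; [exact: Hx|exact: Hy].
Qed.

HB.instance Definition _ :=
  GRing.isZmodClosed.Build {freeg (obj P)} K0_relations K0_relations_zmod.

Definition K0 : zmodType := Quotient.quot K0_relations.

Definition cls (E : obj P) : K0 :=
  \pi_(Quotient.quot K0_relations) << E >>.

End GrothendieckGroup.

Arguments K0_relations {R} P.
Arguments K0 {R} P.

Definition obj_incl (R : realType) (P Q : rep R -> Prop)
    (PQ : forall M, P M -> Q M) (E : obj P) : obj Q :=
  exist Q (E : rep R) (PQ _ (svalP E)).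

Section InducedMap.
Variables (R : realType) (P Q : rep R -> Prop) (PQ : forall M, P M -> Q M).

Let lift : {freeg (obj P)} -> {freeg (obj Q)} :=
  fglift (fun E => << obj_incl PQ E >>).

Let lift_zmod : zmod_morphism lift.
Proof. exact: lift_is_additive. Qed.

Let liftU (E : obj P) : lift << E >> = << obj_incl PQ E >>.
Proof. by rewrite /lift liftU scale1r. Qed.

Let lift0 : lift 0 = 0.
Proof. by rewrite -(subrr 0) lift_zmod subrr. Qed.

Let lift_relations x : x \in K0_relations P -> lift x \in K0_relations Q.
Proof.
move=> /asboolP Hx; apply/asboolP => H [H0 HB] Hr.
apply: (Hx (fun y => lift y \in H)).
  split=> [|y z Hy Hz]; rewrite unfold_in; first by rewrite lift0.
  by rewrite lift_zmod; apply: HB.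
move=> L M N f g fg; rewrite unfold_in !lift_zmod !liftU.
exact: (Hr (obj_incl PQ L) (obj_incl PQ M) (obj_incl PQ N) f g).
Qed.

(* The homomorphism induced by the inclusion of full subcategories. *)
Definition K0_map (x : K0 P) : K0 Q :=
  \pi_(Quotient.quot (K0_relations Q)) (lift (repr x)).

Let K0_map_pi (x : {freeg (obj P)}) :
  K0_map (\pi_(Quotient.quot (K0_relations P)) x)
  = \pi_(Quotient.quot (K0_relations Q)) (lift x).
Proof.
apply/eqP; rewrite /K0_map -Quotient.idealrBE -lift_zmod.
by apply: lift_relations; rewrite Quotient.idealrBE reprK.
Qed.

Lemma K0_map_zmod : zmod_morphism K0_map.
Proof.
move=> x y; rewrite -[x]reprK -[y]reprK -raddfB !K0_map_pi lift_zmod.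
exact: raddfB.
Qed.

HB.instance Definition _ :=
  GRing.isZmodMorphism.Build (K0 P) (K0 Q) K0_map K0_map_zmod.

Lemma K0_map_cls (E : obj P) : K0_map (cls E) = cls (obj_incl PQ E).
Proof. by rewrite /cls K0_map_pi liftU. Qed.

End InducedMap.

Section Stability.
Variable R : realType.

Definition polar (r phi : R) : R[i] :=
  Complex (r * cos (pi * phi)) (r * sin (pi * phi)).

Definition is_phase (z : R[i]) (phi : R) : Prop :=
  [/\ 0 < phi, phi <= 1 & exists2 r : R, 0 < r & z = polar r phi].

Definition in_H (z : R[i]) : Prop := exists phi, is_phase z phi.

(* (1/pi) arg z; the value outside of H is irrelevant. *)
Definition phase (z : R[i]) : R := xget 0 (is_phase z).

Lemma phase_polar (r phi : R) :
  0 < r -> 0 < phi -> phi <= 1 -> phase (polar r phi) = phi.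
Proof.
move=> r0 p0 p1; apply: xget_unique; first by split=> //; exists r.
move=> psi [q0 q1 [s s0 [ec es]]].
have pi0 : 0 < pi :> R := pi_gt0 R.
have rs : r = s.
  apply/eqP; rewrite -(eqrXn2 (n := 2)) ?ltW //; apply/eqP.
  rewrite -[r ^+ 2]mulr1 -(cos2Dsin2 (pi * phi)) mulrDr -!exprMn ec es.
  by rewrite !exprMn -mulrDr cos2Dsin2 mulr1.
have pi_itv (t : R) : 0 < t -> t <= 1 -> pi * t \in `[0, pi].
  move=> t0 t1; rewrite in_itv /= mulr_ge0 ?(ltW t0) ?(ltW pi0) //=.
  by apply: ler_piMr => //; exact: ltW.
move: ec; rewrite -rs => /(mulfI (lt0r_neq0 r0)) /cos_inj.
by move=> /(_ (pi_itv _ p0 p1) (pi_itv _ q0 q1)) /(mulfI (lt0r_neq0 pi0)).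
Qed.

Variable P : rep R -> Prop.

Definition stability_function (Z : {additive K0 P -> R[i]}) : Prop :=
  forall E : obj P, ~ is_zero E -> in_H (Z (cls E)).

(* A proper subobject is a monomorphism that is not an epimorphism. *)
Definition stable (Z : {additive K0 P -> R[i]}) (E : obj P) : Prop :=
  ~ is_zero E /\
  forall (A : obj P) (f : hom A E),
    is_mono f -> ~ is_zero A -> ~ is_epi f ->
    phase (Z (cls A)) < phase (Z (cls E)).

End Stability.

Definition simple_rep (R : realType) (i : 'Z_4) : rep R :=
  @Rep R (fun j => nat_of_bool (j == i)) (fun _ _ => 0)
    (fun _ _ _ _ => etrans (mulmx0 _ _) (esym (mulmx0 _ _))).

Lemma simple_rep_nilpotent (R : realType) (i : 'Z_4) :
  nilpotent_rep (simple_rep R i).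
Proof. by exists 1%N => // j [|a [|]] //= _; rewrite mulmx0. Qed.

Definition gamma (R : realType) (i : 'Z_4) : K0 (@nilpotent_rep R) :=
  cls (exist _ _ (simple_rep_nilpotent R i)).

(* The Phi-invariant stability conditions with heart A, the category of
   nilpotent modules.  Phi acts on K_0 by gamma_i |-> gamma_(i+2).  As A has
   finite length and finitely many simple objects, Harder-Narasimhan filtrations
   and the support property are automatic. *)
Definition stability_U_Phi (R : realType)
    (Z : {additive K0 (@nilpotent_rep R) -> R[i]}) : Prop :=
  stability_function Z /\ forall i, Z (gamma R (i + 2)) = Z (gamma R i).

Definition Zbar (R : realType) (Z : {additive K0 (@nilpotent_rep R) -> R[i]})
    (i : 'Z_4) : {additive K0 (@kron R i) -> R[i]} :=
  (Z : _ -> _) \o K0_map (@kron_nilpotent R i).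

(* Objects and morphisms of rep(K_2), for the quiver K_2 with two parallel
   arrows, again with row vectors. *)
Record kronecker_rep (R : realType) := KroneckerRep {
  ksrc : nat;
  ktgt : nat;
  karr : 'I_2 -> 'M[R[i]]_(ksrc, ktgt) }.

Record kronecker_hom (R : realType) (U V : kronecker_rep R) := KroneckerHom {
  hsrc : 'M[R[i]]_(ksrc U, ksrc V);
  htgt : 'M[R[i]]_(ktgt U, ktgt V);
  htgt_arr : forall a, karr U a *m htgt = hsrc *m karr V a }.

Definition kronecker_isom (R : realType) (U V : kronecker_rep R) : Prop :=
  exists f : kronecker_hom U V,
    [/\ row_free (hsrc f), row_full (hsrc f),
        row_free (htgt f) & row_full (htgt f)].

Definition kron_restr (R : realType) (i : 'Z_4) (M : rep R) :
  kronecker_rep R := KroneckerRep (arr M i).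

Definition kron_restr_hom (R : realType) (i : 'Z_4) (M N : rep R)
    (f : hom M N) : kronecker_hom (kron_restr i M) (kron_restr i N) :=
  @KroneckerHom R (kron_restr i M) (kron_restr i N)
    (hmap f (i + 1)) (hmap f i) (hmap_arr f i).

(* The restriction functor from [kron i] to rep(K_2) is fully faithful and
   essentially surjective. *)
Definition kron_equivalence (R : realType) (i : 'Z_4) : Prop :=
  (forall M N : rep R, kron i M -> kron i N ->
     bijective (@kron_restr_hom R i M N)) /\
  (forall U : kronecker_rep R,
     exists2 M : rep R, kron i M & kronecker_isom (kron_restr i M) U).

(* Main.v *)
Require Import Defs.
From mathcomp Require Import all_boot all_order all_algebra.
From mathcomp Require Import boolp reals complex.
Import Defs GRing.Theory.
Local Open Scope ring_scope.

(** Stability of an object is a condition on its subobjects. A subobject of a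
    module vanishes at every vertex where the module does, so the subobjects of
    [E] in the category of nilpotent modules all lie in [kron i] as soon as [E]
    does ([kron_sub]). As [Zbar Z i] and [Z] take the same value on the class of
    an object of [kron i], the inequalities required of [E] on the two sides are
    the same ones ([stable_incl]).

    The identification of [kron i] with representations of the Kronecker quiver
    rests on the support condition: a module supported on [i] and [i + 1] has
    only the two arrows [i -> i + 1] between nonzero spaces. All squares that a
    morphism must satisfy at the other vertices, and all relations of the
    algebra, factor through a zero space. *)

Set Implicit Arguments.
Unset Strict Implicit.
Unset Printing Implicit Defensive.

Section Subcategory.
Variables (R : realType) (P Q : rep R -> Prop).
Variable PQ : forall M, P M -> Q M.
Variable Z : {additive K0 Q -> R[i]}.

Let ZP : {additive K0 P -> R[i]} := (Z : _ -> _) \o K0_map PQ.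

Lemma stability_function_incl :
  stability_function Z -> stability_function ZP.
Proof. by move=> ZH E E0; rewrite /ZP /= K0_map_cls; apply: ZH. Qed.

(** Closure under subobjects makes every subobject of [E] taken among the
    objects of [Q] a competitor already among the objects of [P], with the same
    central charge. *)
Lemma stable_incl (E : obj P) :
  (forall (A M : rep R) (f : hom A M), is_mono f -> Q A -> P M -> P A) ->
  stable ZP E -> stable Z (obj_incl PQ E).
Proof.
move=> Psub [E0 Est]; split=> // A f fmono A0 fnepi.
have PA : P A by apply: Psub fmono (svalP A) (svalP E).
have {Est} := Est (exist _ (obj_rep A) PA) f fmono A0 fnepi.
rewrite /ZP /= !K0_map_cls.
suff -> : obj_incl PQ (exist _ (obj_rep A) PA) = A by [].
by case: A {f fmono A0 fnepi} PA => A QA PA; apply: eq_exist.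
Qed.

End Subcategory.

(** An injective map bounds the dimension at each vertex, so the support can
    only shrink. *)
Lemma kron_sub (R : realType) (i : 'Z_4) (A E : rep R) (f : hom A E) :
  is_mono f -> nilpotent_rep A -> kron i E -> kron i A.
Proof.
move=> fmono nilA [_ E0]; split=> // j /E0 Ej0; apply/eqP.
by rewrite -leqn0 -Ej0 -(eqP (fmono j)) rank_leq_col.
Qed.

Lemma Z4_succ_neq (i : 'Z_4) : i + 1 != i.
Proof. by case: i => -[|[|[|[|]]]]. Qed.

Lemma Z4_succ2_notin (i : 'Z_4) : i + 1 + 1 \notin [set i; i + 1].
Proof. by rewrite !inE; case: i => -[|[|[|[|]]]]. Qed.

Lemma hom_eq (R : realType) (M N : rep R) (f g : hom M N) :
  (forall j, hmap f j = hmap g j) -> f = g.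
Proof.
case: f g => [f farr] [g garr] /= fg.
have {}fg : f = g by apply: functional_extensionality_dep.
by case: _ / fg garr => garr; congr Hom; apply: Prop_irrelevance.
Qed.

Lemma kronecker_hom_eq (R : realType) (U V : kronecker_rep R)
    (f g : kronecker_hom U V) : hsrc f = hsrc g -> htgt f = htgt g -> f = g.
Proof.
case: f g => [s t farr] [s' t' garr] /= es et; case: _ / es garr => garr.
by case: _ / et garr => garr; congr KroneckerHom; apply: Prop_irrelevance.
Qed.

Lemma mx_eq_no_row (T : Type) m n (A B : 'M[T]_(m, n)) : m = 0%N -> A = B.
Proof. by move=> m0; rewrite m0 in A B *; apply/matrixP=> -[]. Qed.

Lemma mx_eq_no_col (T : Type) m n (A B : 'M[T]_(m, n)) : n = 0%N -> A = B.
Proof. by move=> n0; rewrite n0 in A B *; apply/matrixP=> ? -[]. Qed.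

Section Extension.
Variables (R : realType) (i : 'Z_4).

Section Morphism.
Variables (M N : rep R) (kM : kron i M) (kN : kron i N).
Variable g : kronecker_hom (kron_restr i M) (kron_restr i N).

(** The dimensions agree only after substituting [i] or [i + 1] for [j];
    [conform_mx] resizes without carrying equality proofs. At the other two
    vertices the spaces are zero and any value will do. *)
Definition ext_map (j : 'Z_4) : 'M[R[i]]_(rdim M j, rdim N j) :=
  if j == i then conform_mx 0 (htgt g) else conform_mx 0 (hsrc g).

Lemma ext_map_tgt : ext_map i = htgt g.
Proof. by rewrite /ext_map eqxx conform_mx_id. Qed.

Lemma ext_map_src : ext_map (i + 1) = hsrc g.
Proof. by rewrite /ext_map (negPf (Z4_succ_neq i)) conform_mx_id. Qed.

(** At [i] this is the square of [g]. At [i + 1] the source, which sits at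
    [i + 2], is zero, and at the remaining vertices the target is. *)
Lemma ext_map_arr j a : arr M j a *m ext_map j = ext_map (j + 1) *m arr N j a.
Proof.
have [->|ji] := eqVneq j i.
  by rewrite ext_map_src ext_map_tgt; apply: (htgt_arr g).
have [->|ji1] := eqVneq j (i + 1).
  by apply: mx_eq_no_row; apply: kM.2; apply: Z4_succ2_notin.
by apply: mx_eq_no_col; apply: kN.2; rewrite !inE negb_or ji.
Qed.

Definition ext_hom : hom M N := Hom ext_map_arr.

End Morphism.

Lemma kron_restr_hom_bij (M N : rep R) :
  kron i M -> kron i N -> bijective (@kron_restr_hom R i M N).
Proof.
move=> kM kN; exists (ext_hom kM kN) => [f|g].
  apply: hom_eq => j.
  have [->|ji] := eqVneq j i; first exact: ext_map_tgt.
  have [->|ji1] := eqVneq j (i + 1); first exact: ext_map_src.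
  by apply: mx_eq_no_row; apply: kM.2; rewrite !inE negb_or ji.
by apply: kronecker_hom_eq; [exact: ext_map_src | exact: ext_map_tgt].
Qed.

Section Object.
Variable U : kronecker_rep R.

Definition ext_dim (j : 'Z_4) : nat :=
  if j == i then ktgt U else if j == i + 1 then ksrc U else 0%N.

Definition ext_arr (j : 'Z_4) (a : 'I_2) :
    'M[R[i]]_(ext_dim (j + 1), ext_dim j) :=
  if j == i then conform_mx 0 (karr U a) else 0.

(** Only arrows starting at [i] act nontrivially, and two consecutive arrows
    cannot both start there. This yields the cubic relations and nilpotency. *)
Lemma ext_arr_comp j a b : ext_arr (j + 1) a *m ext_arr j b = 0.
Proof.
rewrite /ext_arr; have [->|_] := eqVneq j i; last by rewrite mulmx0.
by rewrite (negPf (Z4_succ_neq i)) mul0mx.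
Qed.

Lemma ext_arr_rel j (a b c : 'I_2) :
  ext_arr (j + 1 + 1) a *m ext_arr (j + 1) b *m ext_arr j c
  = ext_arr (j + 1 + 1) c *m ext_arr (j + 1) b *m ext_arr j a.
Proof. by rewrite !ext_arr_comp !mul0mx. Qed.

Definition ext_rep : rep R := Rep ext_arr_rel.

Lemma ext_rep_kron : kron i ext_rep.
Proof.
split=> [|j].
  exists 2 => // j [|a [|b [|]]] //= _.
  by rewrite mul1mx; apply: ext_arr_comp.
by rewrite !inE negb_or /= /ext_dim => /andP[/negPf -> /negPf ->].
Qed.

Lemma ext_rep_restr : kronecker_isom (kron_restr i ext_rep) U.
Proof.
have dt : ext_dim i = ktgt U by rewrite /ext_dim eqxx.
have ds : ext_dim (i + 1) = ksrc U.
  by rewrite /ext_dim (negPf (Z4_succ_neq i)) eqxx.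
pose s : 'M[R[i]]_(ext_dim (i + 1), ksrc U) :=
    conform_mx 0 (1%:M : 'M_(ksrc U)).
pose t : 'M[R[i]]_(ext_dim i, ktgt U) :=
    conform_mx 0 (1%:M : 'M_(ktgt U)).
have st_arr a : ext_arr i a *m t = s *m karr U a.
  rewrite /ext_arr eqxx /s /t.
  case: _ / (esym dt); case: _ / (esym ds).
  by rewrite !conform_mx_id mulmx1 mul1mx.
exists (@KroneckerHom _ (kron_restr i ext_rep) U s t st_arr).
(* Up to the equalities of dimensions, [s] and [t] are identity matrices. *)
have id_iso m n : m = n ->
    row_free (conform_mx (0 : 'M[R[i]]_(m, n)) (1%:M : 'M_n)) /\
    row_full (conform_mx (0 : 'M[R[i]]_(m, n)) (1%:M : 'M_n)).
  move=> ->; rewrite conform_mx_id.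
  by rewrite row_free_unit row_full_unit unitmx1.
by have [] := id_iso _ _ ds; have [] := id_iso _ _ dt.
Qed.

End Object.

Lemma kron_restr_equivalence : kron_equivalence R i.
Proof.
split=> [M N|U]; first exact: kron_restr_hom_bij.
by exists (ext_rep U); [exact: ext_rep_kron | exact: ext_rep_restr].
Qed.

End Extension.

Unset Implicit Arguments.

Theorem lemma1p1 (R : realType)
    (Z : {additive K0 (@nilpotent_rep R) -> R[i]})
    (hZ : stability_U_Phi Z) (i : 'Z_4) :
  [/\ kron_equivalence R i,
      stability_function (Zbar Z i) &
      forall E : obj (@kron R i),
        stable (Zbar Z i) E ->
        stable Z (obj_incl (@kron_nilpotent R i) E)].
Proof.
split; first exact: kron_restr_equivalence.
  by apply: stability_function_incl; case: hZ.
by move=> E; apply: stable_incl => A M f; apply: kron_sub.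
Qed.
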